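(* Let $n \ge 3$ be an integer and let $\Im$ be a strongly balanced tiling of the plane all of whose tiles are convex $n$-gons. Then $$3 \le \sum_{j \ge 3} j \cdot w_j(\Im) \le \frac{2n}{n-2}.$$
   Context: A tiling is a collection of closed sets (tiles) covering the plane with pairwise disjoint interiors. A convex $n$-gon is a convex polygon with exactly $n$ sides and $n$ corners (all interior angles less than $180^\circ$); the tiles of a tiling by convex $n$-gons need not be congruent and the tiling need not be edge-to-edge. A vertex of the tiling is a point belonging to at least three tiles, and its valence is the number of tiles meeting there (so valences are at least three). The vertices divide the boundaries of the tiles into arcs, called the edges of the tiling. (Corners and sides belong to the polygons; vertices and edges belong to the tiling.) Two distinct tiles are adjacent if they have an edge of the tiling in common; the adjacents of a tile are the tiles adjacent to it. A tiling is normal if (i) every tile is a topological disk; (ii) the intersection of every two tiles is a connected set; (iii) the tiles are uniformly bounded: there are $u,U>0$ such that every tile contains some disk of radius $u$ and is contained in some disk of radius $U$. For $r>0$ and an arbitrary point $M$ of the plane, let $D(r,M)$ be the closed disk of radius $r$ centered at $M$. Let $F_1$ be the set of tiles contained in $D(r,M)$, $F_2$ the set of tiles meeting the boundary of $D(r,M)$ but not contained in $D(r,M)$, and $F_3$ the set of tiles surrounded by the tiles of $F_2$ but not belonging to $F_2$. The patch $A(r,M)$ is $F_1\cup F_2\cup F_3$. Let $t(r,M)$ and $v(r,M)$ be the numbers of tiles and vertices in $A(r,M)$, $t_h(r,M)$ the number of tiles in $A(r,M)$ with exactly $h$ adjacents, and $v_j(r,M)$ the number of $j$-valent vertices in $A(r,M)$.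 A tiling $\Im$ is strongly balanced if it is normal and all the limits $t_h(\Im)=\lim_{r\to\infty} t_h(r,M)/t(r,M)$ and $v_j(\Im)=\lim_{r\to\infty} v_j(r,M)/t(r,M)$ exist. Then $v(\Im)=\lim_{r\to\infty} v(r,M)/t(r,M)$ exists, equals $\sum_{j\ge 3}v_j(\Im)$, and one sets $w_j(\Im)=v_j(\Im)/v(\Im)$. *)

(* Defs.v *)
From HB Require Import structures.
From mathcomp Require Import all_boot all_order all_algebra.
From mathcomp Require Import finmap.
From mathcomp Require Import all_classical all_reals all_analysis.

Set Implicit Arguments.
Unset Strict Implicit.
Unset Printing Implicit Defensive.

Import Order.TTheory GRing.Theory Num.Theory.
Import numFieldNormedType.Exports.

Local Open Scope classical_set_scope.
Local Open Scope ring_scope.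


Section Plane.
Variable R : realType.
Local Notation plane := (R * R)%type.

(* The library norm on [R * R] is the max norm, so the Euclidean disk is written
   out; the topology and the bounded sets of the plane are those of [R * R]. *)
Definition disk (r : R) (M : plane) : set plane :=
  [set p | Num.sqrt ((p.1 - M.1) ^+ 2 + (p.2 - M.2) ^+ 2) <= r].

Definition boundary (A : set plane) : set plane := closure A `\` A°.

Definition topological_disk (A : set plane) : Prop :=
  exists f g : plane -> plane,
    [/\ {within disk 1 0, continuous f}, {within A, continuous g},
        f @` disk 1 0 = A, g @` A = disk 1 0 &
        (forall x, disk 1 0 x -> g (f x) = x) /\
        (forall y, A y -> f (g y) = y)].

Definition cross (u v : plane) : R := u.1 * v.2 - u.2 * v.1.

Definition convex_hull (A : set plane) : set plane :=
  smallest (fun B => convex_set B) A.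

(* The corners [c] are listed counterclockwise ([ordS] is the cyclic successor
   in ['I_n]) and the sides are the segments from [c i] to [c (ordS i)]. Every
   other corner lies strictly to the left of the line through a side, so, for
   [3 <= n], every [c i] is a corner with interior angle less than 180 degrees
   and there are exactly [n] sides. *)
Definition convex_ngon (n : nat) (P : set plane) : Prop :=
  exists c : 'I_n -> plane,
    (forall i k : 'I_n, k != i -> k != ordS i ->
       0 < cross (c (ordS i) - c i) (c k - c i)) /\
    P = convex_hull (range c).

End Plane.

Section Tiling.
Variable R : realType.
Local Notation plane := (R * R)%type.
Implicit Types (Tl : set (set plane)) (T e X : set plane) (M x : plane).

Definition tiling Tl : Prop :=
  [/\ forall T, Tl T -> closed T,
      \bigcup_(T in Tl) T = setT &
      forall S T, Tl S -> Tl T -> S <> T -> S° `&` T° = set0].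

Definition normal_tiling Tl : Prop :=
  [/\ tiling Tl,
      forall T, Tl T -> topological_disk T,
      forall S T, Tl S -> Tl T -> connected (S `&` T) &
      exists u U : R, [/\ 0 < u, 0 < U &
        forall T, Tl T ->
          (exists a, disk u a `<=` T) /\ (exists b, T `<=` disk U b)]].

Definition tiles_at Tl x : set (set plane) := [set T | Tl T /\ T x].

Definition vertices Tl : set plane := [set x | (`I_3 #<= tiles_at Tl x)%card].

Definition has_valence Tl (j : nat) x : Prop := (tiles_at Tl x #= `I_j)%card.

(* Removing the vertices from the boundary of [T] leaves open arcs; the edges
   are these arcs together with their endpoints. *)
Definition edge_of Tl T e : Prop :=
  exists2 x, (boundary T `\` vertices Tl) x &
    e = closure (connected_component (boundary T `\` vertices Tl) x).

Definition adjacent Tl S T : Prop :=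
  S <> T /\ exists e, edge_of Tl S e /\ edge_of Tl T e.

Definition has_adjacents Tl (h : nat) T : Prop :=
  ([set S | Tl S /\ adjacent Tl T S] #= `I_h)%card.

Definition inner_tiles Tl (r : R) M : set (set plane) :=
  [set T | Tl T /\ T `<=` disk r M].

Definition rim_tiles Tl (r : R) M : set (set plane) :=
  [set T | [/\ Tl T, T `&` boundary (disk r M) !=set0 &
               ~ (T `<=` disk r M)]].

(* The interior of [T] is used because the tiles of a tiling that is surrounded
   by [X] may share boundary points with [X]. *)
Definition surrounded X T : Prop :=
  exists x, [/\ (~` X) x, bounded_set (connected_component (~` X) x) &
                T° `<=` connected_component (~` X) x].

Definition enclosed_tiles Tl (r : R) M : set (set plane) :=
  [set T | [/\ Tl T, surrounded (\bigcup_(S in rim_tiles Tl r M) S) T &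
               ~ rim_tiles Tl r M T]].

Definition patch Tl (r : R) M : set (set plane) :=
  inner_tiles Tl r M `|` rim_tiles Tl r M `|` enclosed_tiles Tl r M.

Definition patch_vertices Tl (r : R) M : set plane :=
  vertices Tl `&` \bigcup_(T in patch Tl r M) T.

(* [fset_set A] is empty when [A] is infinite; in a normal tiling every patch
   has finitely many tiles and vertices. *)
Definition ncard (I : choiceType) (A : set I) : R := (#|` fset_set A|)%:R.

Definition t_ Tl (r : R) M : R := ncard (patch Tl r M).

Definition v_ Tl (r : R) M : R := ncard (patch_vertices Tl r M).

Definition th_ Tl (h : nat) (r : R) M : R :=
  ncard [set T | patch Tl r M T /\ has_adjacents Tl h T].

Definition vj_ Tl (j : nat) (r : R) M : R :=
  ncard [set x | patch_vertices Tl r M x /\ has_valence Tl j x].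

(* The limits are taken along the disks centered at one given point [M]. *)
Definition strongly_balanced Tl M : Prop :=
  [/\ normal_tiling Tl,
      forall h, cvg (th_ Tl h r M / t_ Tl r M @[r --> +oo]) &
      forall j, cvg (vj_ Tl j r M / t_ Tl r M @[r --> +oo])].

Definition v_lim Tl M : R := lim (v_ Tl r M / t_ Tl r M @[r --> +oo]).

Definition vj_lim Tl M (j : nat) : R :=
  lim (vj_ Tl j r M / t_ Tl r M @[r --> +oo]).

Definition w_ Tl M (j : nat) : R := vj_lim Tl M j / v_lim Tl M.

End Tiling.

(* Main.v *)
Require Import Defs.
From HB Require Import structures.
From mathcomp Require Import all_boot all_order all_algebra.
From mathcomp Require Import finmap.
From mathcomp Require Import all_classical all_reals all_analysis.
From mathcomp Require Import ring lra zify.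

Set Implicit Arguments.
Unset Strict Implicit.
Unset Printing Implicit Defensive.

Import Order.TTheory GRing.Theory Num.Theory.
Import numFieldNormedType.Exports.

Local Open Scope classical_set_scope.
Local Open Scope ring_scope.

(** The sum of the valences is the number of incidences between vertices and
    tiles, and Euler's relation between vertices, edges and tiles amounts to
    counting angles: a convex tile with [k] vertices of the tiling on its
    boundary has angle sum [(k - 2) * pi], and the angles at a vertex add up to
    [2 * pi]. With [v] vertices and [t] tiles, and up to the margin of the
    patch, the number of incidences is therefore [2 * v + 2 * t], while the [n]
    corners of each tile, all of which are vertices, give
    [(n - 2) * t <= 2 * v]. Hence the mean valence is at most
    [2 + 2 * t / v <= 2 + 4 / (n - 2) = 2 * n / (n - 2)]. It is at least 3
    because all valences are.

    No angle is measured below. Fix a direction [d] parallel to no side of any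
    tile; one exists because the tiles are countable. In place of the angle of
    a tile [T] at a point [x], divided by pi, count how many of the two rays
    from [x] in the directions [d] and [- d] start inside [T]. Each ray enters
    at most one tile ([enters_unique]), which replaces the full angle at a
    vertex, and a polygon is entered by exactly one ray at all its boundary
    points but the two that are extreme across [d], which are corners
    ([blocked_corners]); this replaces the angle sum ([sum_entrances]). The two
    resulting counts for a patch are [patch_corners] and [sum_valence]. The
    same device shows that every vertex is a corner of some tile
    ([vertex_corner]), so that vertices are as sparse as tiles.

    The vertices outside the disk are the error term of the second count. They
    lie in an annulus of bounded width ([patch_near]), and since the number of
    vertices in a disk grows at most quadratically with the radius, they are a
    negligible part of all vertices for arbitrarily large radii
    ([frequently_thin_margin]). This suffices, because the limits exist by
    hypothesis. Valences are bounded, so all the sums over [j] are finite and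
    commute with the limits. *)

(** * Finite sums, cardinals and growth *)

Lemma card_le_inj {I J : Type} (f : I -> J) (A : set I) (B : set J) :
  (forall i, A i -> B (f i)) -> {in A &, injective f} -> (A #<= B)%card.
Proof.
move=> fAB /inj_card_eq/card_le_eql <-; apply: subset_card_le.
by move=> _ [i Ai <-]; exact: fAB.
Qed.

Lemma three_elements {I : choiceType} (A : set I) : (`I_3 #<= A)%card <->
  exists a b c, [/\ A a, A b & A c] /\ [/\ a <> b, b <> c & a <> c].
Proof.
split.
  move=> /card_leP[f].
  pose s k (k3 : `I_3 k) : `I_3 := SigSub (mem_set k3).
  pose s0 := s 0%N isT; pose s1 := s 1%N isT; pose s2 := s 2%N isT.
  have fA z : A (val (f z)) by exact: set_mem (valP (f z)).
  have f_inj z t : val (f z) = val (f t) -> z = t.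
    by move=> /val_inj; apply: inj; rewrite inE.
  exists (val (f s0)), (val (f s1)), (val (f s2)); split; first by split.
  by split=> /f_inj /(congr1 val).
move=> [a [b [c [[Aa Ab Ac] [ab bc ac]]]]].
pose f (k : nat) := nth a [:: a; b; c] k.
apply: (@card_le_inj _ _ f) => [[|[|[|]]]//|i j]; rewrite !inE.
by case: i => [|[|[|i]]]; case: j => [|[|[|j]]] //= _ _ fij; exfalso;
  rewrite /f /= in fij; congruence.
Qed.

Lemma finite_le_II {I : Type} (A : set I) m : (A #<= `I_m)%card -> finite_set A.
Proof. by move=> Am; apply: card_le_finite Am _; exact: finite_II. Qed.

Lemma sum_pred1 {I : choiceType} (Y : {fset I}) (p : I) : p \in Y ->
  (\sum_(x <- Y) (x == p) = 1)%N.
Proof. by move=> pY; rewrite -big_mkcond sum1_count count_uniq_mem ?pY. Qed.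

Lemma sum_le1 {I : choiceType} (Y : {fset I}) (P : pred I) :
  {in Y &, forall x y : I, P x -> P y -> x = y} -> (\sum_(x <- Y) P x <= 1)%N.
Proof.
move=> PY; have [|/hasPn nP] := boolP (has P Y).
  case/hasP => p pY Pp; rewrite -(sum_pred1 pY) big_seq [X in (_ <= X)%N]big_seq.
  apply: leq_sum => x xY.
  by case: (boolP (P x)) => // Px; rewrite (PY _ _ xY pY) ?eqxx.
by rewrite big_seq big1 // => x /nP/negbTE ->.
Qed.

Lemma leq_sum_fsubset {I : choiceType} (Y Z : {fset I}) (f : I -> nat) :
  (Y `<=` Z)%fset -> (\sum_(x <- Y) f x <= \sum_(x <- Z) f x)%N.
Proof.
move=> /fsubsetP YZ; apply: (uniq_sub_le_big leqnn) => //.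
by move=> x y; exact: leq_addr.
Qed.

Lemma leq_card_sum {I : choiceType} (Y Z : {fset I}) (P : pred I) :
  (Y `<=` Z)%fset -> {in Y, forall x : I, P x} -> (#|` Y| <= \sum_(x <- Z) P x)%N.
Proof.
move=> YZ YP; apply: leq_trans (leq_sum_fsubset _ YZ).
by rewrite -sum1_size big_seq [X in (_ <= X)%N]big_seq leq_sum // => x /YP ->.
Qed.

Lemma sum_by_value {A : pzSemiRingType} (f : nat -> A) a b k : (a <= k < b)%N ->
  \sum_(a <= j < b) f j * (k == j)%:R = f k.
Proof.
move=> kab; rewrite (bigD1_seq k) ?iota_uniq ?mem_index_iota //= eqxx mulr1.
by rewrite big1 ?addr0 // => j /negbTE jk; rewrite eq_sym jk mulr0.
Qed.

(** Bernoulli's inequality makes [(1 + e) ^+ (m * 3)] at least the cube of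
    [1 + m * e]. *)
Lemma exp_beats_quadratic {R : realType} (e A B : R) : 0 < e -> 0 <= A -> 0 <= B ->
  exists k : nat, (A + B * k%:R) ^+ 2 < (1 + e) ^+ k.
Proof.
move=> e0 A0 B0.
pose q := (A + 3 * B) ^+ 2 / e ^+ 3.
have q0 : 0 <= q by rewrite divr_ge0 ?exprn_ge0 // ?addr_ge0 ?mulr_ge0 // ltW.
pose m := (Num.trunc q).+1.
have m1 : 1 <= m%:R :> R by rewrite ler1n.
have qm : q < m%:R by exact: truncnS_gt.
exists (m * 3)%N; rewrite exprM natrM.
have bern : 1 + m%:R * e <= (1 + e) ^+ m.
  elim: (m) => [|i IH]; first by rewrite mul0r addr0 expr0.
  rewrite exprS -natr1; have i0 : 0 <= i%:R :> R by [].
  have ei : 0 <= i%:R * e * e by rewrite !mulr_ge0 // ltW.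
  apply: (@le_trans _ _ ((1 + e) * (1 + i%:R * e))); first by nra.
  by rewrite ler_pM2l //; lra.
apply: (@lt_le_trans _ _ ((m%:R * e) ^+ 3)); last first.
  have me0 : 0 <= m%:R * e by rewrite mulr_ge0 // ltW.
  have me : m%:R * e <= (1 + e) ^+ m by lra.
  by rewrite ler_pXn2r ?nnegrE // (le_trans me0).
have step : (A + B * (m%:R * 3)) ^+ 2 <= m%:R ^+ 2 * (A + 3 * B) ^+ 2.
  rewrite -exprMn ler_pXn2r ?nnegrE ?mulr_ge0 ?addr_ge0 ?mulr_ge0 //.
  by nra.
apply: le_lt_trans step _.
rewrite exprMn [m%:R ^+ 3]exprSr -mulrA ltr_pM2l; last by rewrite exprn_gt0 //; lra.
by rewrite -ltr_pdivrMr ?exprn_gt0.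
Qed.

(** * Convex sets and disks in the plane *)

Section Plane.
Context {R : realType}.
Local Notation plane := (R * R)%type.
Implicit Types (a b d x y M : plane) (T : set plane) (e r s : R).

Lemma crossBr a b d : cross d (a - b) = cross d a - cross d b.
Proof. by rewrite /cross /=; ring. Qed.

Lemma crossDr a b d : cross d (a + b) = cross d a + cross d b.
Proof. by rewrite /cross /=; ring. Qed.

Lemma crossZr (e : R) a d : cross d (e *: a) = e * cross d a.
Proof. by rewrite /cross /=/GRing.scale/=; ring. Qed.

Lemma crossNr a d : cross d (- a) = - cross d a.
Proof. by rewrite /cross /=; ring. Qed.

Lemma cross_via (x a b d : plane) :
  cross a (d - b) = cross a (d - x) + cross a (x - b).
Proof. by rewrite /cross /=; ring. Qed.

Lemma cross_shift (e : R) x d a b :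
  cross a (x + e *: d - b) = cross a (x - b) + e * cross a d.
Proof. by rewrite !crossBr crossDr crossZr; ring. Qed.

Lemma convex_segment (T : set plane) x y (t : R) :
  convex_set T -> T x -> T y -> 0 <= t <= 1 -> T (t *: x + (1 - t) *: y).
Proof.
move=> cT Tx Ty t01.
pose p : {i01 R} := Itv01 (andP t01).1 (andP t01).2.
by have := cT x y p; rewrite !inE => /(_ Tx Ty).
Qed.

Lemma convex_setP T :
  (forall x y (t : R), T x -> T y -> 0 <= t <= 1 ->
    T (t *: x + (1 - t) *: y)) -> convex_set T.
Proof.
move=> cT x y p; rewrite !inE => Tx Ty.
by apply: cT => //; rewrite ge0 le1.
Qed.

Lemma frac01 (s t : R) : 0 < t -> 0 <= s <= t -> 0 <= s / t <= 1.
Proof.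
move=> t0 /andP[s0 st]; rewrite ler_pdivrMr // mul1r st andbT.
by rewrite divr_ge0 // ltW.
Qed.

Lemma halfplane_convex a b : convex_set [set y | 0 <= cross a (y - b)].
Proof.
apply: convex_setP => x y t /= x0 y0 /andP[t0 t1].
have -> : cross a (t *: x + (1 - t) *: y - b) =
    t * cross a (x - b) + (1 - t) * cross a (y - b).
  by rewrite /cross /= /GRing.scale /=; ring.
by rewrite addr_ge0 // mulr_ge0 // subr_ge0.
Qed.

(** Solving for the barycentric coordinates of [y] by Cramer's rule. *)
Lemma triangle_convex T a b d y : convex_set T -> T a -> T b -> T d ->
  0 < cross (b - a) (d - a) -> 0 <= cross (b - a) (y - a) ->
  0 <= cross (d - b) (y - b) -> cross (d - a) (y - a) <= 0 -> T y.
Proof.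
move=> cT Ta Tb Td D0 h1 h2 h3.
set D := cross (b - a) (d - a) in D0.
set u := cross (b - a) (y - a) in h1; set v := cross (d - b) (y - b) in h2.
set w := cross (d - a) (y - a) in h3.
have Duvw : D = u + v - w by rewrite /D /u /v /w /cross /=; ring.
have yE : D *: y = u *: d + v *: a - w *: b.
  by congr (_, _); rewrite /D /u /v /w /cross /= /GRing.scale /=; ring.
have Dn0 := lt0r_neq0 D0.
have [vw0|vw0] := eqVneq (v - w) 0.
  have [v0 w0] : v = 0 /\ w = 0 by split; lra.
  have Du : u = D by rewrite Duvw v0 w0; ring.
  suff -> : y = d by [].
  apply: (scalerI Dn0); rewrite yE Du v0 w0 !scale0r addr0 subr0 //.
have vwp : 0 < v - w by rewrite lt_def vw0; lra.
have -> : y = (u / D) *: d + (1 - u / D) *: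
    ((v / (v - w)) *: a + (1 - v / (v - w)) *: b).
  apply: (scalerI Dn0); rewrite yE.
  congr (_, _); rewrite /= /GRing.scale /= ?Duvw; field; rewrite vw0 /=;
    by rewrite -Duvw.
apply: convex_segment => //; first apply: convex_segment => //.
  by apply: frac01; lra.
by apply: frac01; lra.
Qed.

(** A combinatorial substitute for angles: averaged over all [d], the number of
    the two directions [d] and [- d] that enter a polygon at [x] is its angle at
    [x] divided by pi. *)
Definition enters d T x := T x /\ exists2 e : R, 0 < e & T (x + e *: d).

Lemma entersW d T x e : convex_set T -> T x -> 0 < e -> T (x + e *: d) ->
  forall e', 0 <= e' <= e -> T (x + e' *: d).
Proof.
move=> cT Tx e0 Txe e' /andP[e'0 e'e].
have -> : x + e' *: d = (e' / e) *: (x + e *: d) + (1 - e' / e) *: x.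
  by congr (_, _); rewrite /= /GRing.scale /=; field; rewrite gt_eqF.
apply: convex_segment => //.
by apply: frac01; lra.
Qed.

Lemma plane_eq x y : x.1 = y.1 -> x.2 = y.2 -> x = y.
Proof. by case: x y => [x1 x2] [y1 y2] /= -> ->. Qed.

Lemma ballP x e y :
  ball x e y <-> `|x.1 - y.1| < e /\ `|x.2 - y.2| < e.
Proof. by []. Qed.

(** The homothety with center [x] and ratio [s] maps the ball around [a] to a
    ball around [x + s *: (a - x)] that stays in [T]. *)
Lemma convex_interior T (a x : plane) e s : convex_set T -> ball a e `<=` T ->
  T x -> 0 < e -> 0 < s <= 1 -> T° (x + s *: (a - x)).
Proof.
move=> cT aT Tx e0 /andP[s0 s1].
apply: (@filterS _ (nbhs (x + s *: (a - x))) _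
    (ball (x + s *: (a - x)) (s * e))); last first.
  by apply: nbhsx_ballx; rewrite mulr_gt0.
move=> z /ballP[/=]; rewrite /GRing.scale /= => z1 z2.
have -> : z = s *: (x + s^-1 *: (z - x)) + (1 - s) *: x.
  by apply: plane_eq; rewrite /= /GRing.scale /=; field; rewrite gt_eqF.
apply: convex_segment => //; last by rewrite ltW.
apply: aT; apply/ballP; rewrite /= /GRing.scale /=.
split; rewrite -(ltr_pM2l s0) -[X in X * `|_|](gtr0_norm s0) -normrM.
  move: z1; congr (`| _ | < _); field; exact: lt0r_neq0.
move: z2; congr (`| _ | < _); field; exact: lt0r_neq0.
Qed.

Lemma continuous_ray x d : continuous (fun s : R => x + s *: d).
Proof.
move=> s; apply: cvgD; first exact: cvg_cst.
by apply: cvgZl; exact: cvg_id.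
Qed.

Lemma near_ray x d (A : set plane) : nbhs x A ->
  \forall s \near (0 : R)^'+, A (x + s *: d).
Proof.
move=> xA; apply: (cvg_at_right_filter (@continuous_ray x d 0)).
by rewrite scale0r addr0.
Qed.

Lemma continuous_cross (a b : plane) : continuous (fun y : plane => cross a (y - b)).
Proof.
move=> y; rewrite /cross /=; apply: cvgB; apply: cvgMr => /=;
 apply: cvgB; try exact: cvg_cst; [exact: cvg_snd|exact: cvg_fst].
Qed.

Lemma diskP r M x : 0 <= r ->
  disk r M x <-> (x.1 - M.1) ^+ 2 + (x.2 - M.2) ^+ 2 <= r ^+ 2.
Proof.
move=> r0; have sq0 : 0 <= (x.1 - M.1) ^+ 2 + (x.2 - M.2) ^+ 2.
  by rewrite addr_ge0 ?sqr_ge0.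
by rewrite /disk /= -(ler_pXn2r (_ : (0 < 2)%N)) ?nnegrE ?sqrtr_ge0 // sqr_sqrtr.
Qed.

Lemma ler_norm_sqr (s r : R) : 0 <= r -> s ^+ 2 <= r ^+ 2 -> `|s| <= r.
Proof.
by move=> r0; rewrite -(real_normK (num_real s)) ler_pXn2r ?nnegrE.
Qed.

(** The ball is that of the max norm; the factor 2 exceeds the ratio of the
    Euclidean norm to it. *)
Lemma disk_ball r M x y e : 0 <= r -> disk r M x -> ball x e y ->
  disk (r + 2 * e) M y.
Proof.
move=> r0 /(diskP _ _ r0) rx /ballP[xy1 xy2].
have e0 : 0 < e by exact: le_lt_trans (normr_ge0 _) xy1.
apply/diskP; first by nra.
have /(ler_norm_sqr r0) : (x.1 - M.1) ^+ 2 <= r ^+ 2.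
  by apply: le_trans rx; rewrite lerDl sqr_ge0.
have /(ler_norm_sqr r0) : (x.2 - M.2) ^+ 2 <= r ^+ 2.
  by apply: le_trans rx; rewrite lerDr sqr_ge0.
move: xy1 xy2 rx; rewrite !ltr_norml !ler_norml => /andP[h1 h2] /andP[h3 h4] rx
  /andP[h5 h6] /andP[h7 h8].
have -> : y.1 - M.1 = (x.1 - M.1) - (x.1 - y.1) by ring.
have -> : y.2 - M.2 = (x.2 - M.2) - (x.2 - y.2) by ring.
move: (x.1 - M.1) (x.2 - M.2) (x.1 - y.1) (x.2 - y.2) h1 h2 h3 h4 h5 h6 h7 h8 rx
  => a b h k h1 h2 h3 h4 h5 h6 h7 h8 rx.
have ah : - (r * e) <= a * h by nra.
have bk : - (r * e) <= b * k by nra.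
have hh : h ^+ 2 <= e ^+ 2 by nra.
have kk : k ^+ 2 <= e ^+ 2 by nra.
by nra.
Qed.

Lemma disk_sub_ball r M : 0 <= r -> disk r M `<=` ball M (r + 1).
Proof.
move=> r0 x /(diskP _ _ r0) rx; apply/ballP.
have r1 : r < r + 1 by rewrite ltrDl.
by split; rewrite distrC; apply: le_lt_trans r1; apply: ler_norm_sqr => //;
  apply: le_trans rx;
  rewrite ?lerDl ?lerDr sqr_ge0.
Qed.

(** Moving away from the center, however little, leaves the disk. *)
Lemma boundary_disk r M x : 0 < r ->
  (x.1 - M.1) ^+ 2 + (x.2 - M.2) ^+ 2 = r ^+ 2 -> boundary (disk r M) x.
Proof.
move=> r0 xr; split; first by apply: subset_closure; apply/diskP; rewrite ?xr // ltW.
move=> /(near_ray (x - M)) near_s.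
suff [//] : exists s : R, False.
apply: (@filter_ex _ (0 : R)^'+); near=> s.
have s0 : 0 < s by near: s; exact: nbhs_right_gt.
have : disk r M (x + s *: (x - M)) by near: s.
have r_ge0 := ltW r0; move=> /(diskP _ _ r_ge0).
rewrite /= /GRing.scale /=.
have -> : (x.1 + s * (x.1 - M.1) - M.1) ^+ 2 + (x.2 + s * (x.2 - M.2) - M.2) ^+ 2 =
    (1 + s) ^+ 2 * ((x.1 - M.1) ^+ 2 + (x.2 - M.2) ^+ 2) by ring.
rewrite xr; have : 0 < r ^+ 2 by rewrite exprn_gt0.
by move: (r ^+ 2) => q q0; nra.
Unshelve. all: by end_near. Qed.

Lemma ball_sub_disk r M : 0 <= r -> ball M (r / 2) `<=` disk r M.
Proof.
move=> r0 x /ballP[]; rewrite !ltr_norml => /andP[h1 h2] /andP[h3 h4].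
by apply/(diskP _ _ r0); nra.
Qed.

End Plane.

(** * Convex polygons *)

Section Ngon.
Context {R : realType} {n : nat}.
Local Notation plane := (R * R)%type.
Implicit Types (d x y p q : plane).

Definition counterclockwise (c : 'I_n -> plane) :=
  forall i k : 'I_n, k != i -> k != ordS i ->
    0 < cross (c (ordS i) - c i) (c k - c i).

Context {c : 'I_n -> plane}.
Hypothesis n3 : (3 <= n)%N.
Hypothesis ccw : counterclockwise c.
Local Notation side i := (c (ordS i) - c i).
Local Notation P := (convex_hull (range c)).

Lemma cross_side_ge0 i k : 0 <= cross (side i) (c k - c i).
Proof.
have [->|ki] := eqVneq k i; first by rewrite /cross /=; lra.
have [->|kSi] := eqVneq k (ordS i); first by rewrite /cross /=; lra.
by apply: ltW; apply: ccw.
Qed.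

Lemma corner_in_hull i : P (c i).
Proof. by apply: sub_gen_smallest; exists i. Qed.

Lemma hull_convex : convex_set P.
Proof.
apply: convex_setP => x y t Px Py t01 B [cB sB].
by apply: convex_segment => //; [apply: Px|apply: Py].
Qed.

Lemma third_corner i : exists2 k : 'I_n, k != i & k != ordS i.
Proof.
have : (0 < #|~: [set i; ordS i]|)%N.
  have := cardsC [set i; ordS i]; rewrite card_ord cards2.
  by case: (_ != _); case: #|_| => //= nE; have := n3; rewrite -nE.
by case/card_gt0P => k; rewrite !inE negb_or => /andP[]; exists k.
Qed.

Lemma ordS_val (i : 'I_n) : val (ordS i) = if i.+1 == n then 0%N else i.+1.
Proof.
rewrite /=; case: eqP => [->|iS]; first by rewrite modnn.
by rewrite modn_small //; have := ltn_ord i; lia.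
Qed.

(** A point on the left of all the sides lies in a triangle of the fan with
    apex a fixed corner: the diagonals from that corner leave the point first
    on their left and then on their right, and the triangle between two
    consecutive diagonals where this changes contains it. *)
Lemma hullP y : P y <-> forall i, 0 <= cross (side i) (y - c i).
Proof.
split=> [Py i|Hy].
  apply: (Py [set y | 0 <= cross (side i) (y - c i)]).
  by split; [exact: halfplane_convex|move=> _ [k _ <-]; exact: cross_side_ge0].
pose o (k : nat) : 'I_n := insubd (Ordinal (ltnW (ltnW n3))) k.
have oE k : (k < n)%N -> val (o k) = k by move=> kn; rewrite val_insubd kn.
have oS k : (k.+1 < n)%N -> ordS (o k) = o k.+1.
  by move=> kn; apply/val_inj; rewrite ordS_val !oE ?ifF //; lia.
have n10 : ordS (o n.-1) = o 0.
  by apply/val_inj; rewrite ordS_val !oE ?ifT //; lia.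
pose f k := cross (c (o k) - c (o 0)) (y - c (o 0)).
have exf : exists k, (2 <= k < n)%N && (f k <= 0).
  exists n.-1; have := Hy (o n.-1); rewrite n10 => h.
  have -> /= : (2 <= n.-1 < n)%N by lia.
  suff : - cross (c (o 0) - c (o n.-1)) (y - c (o n.-1)) = f n.-1 by lra.
  by rewrite /f /cross /=; ring.
case: (ex_minnP exf) => k /andP[/andP[k2 kn] fk] kmin.
have k1 : (k.-1.+1 = k)%N by lia.
have kn1 : (k.-1 < n)%N by lia.
have n0 : (0 < n)%N by lia.
have fk1 : 0 <= f k.-1.
  have [k2E|k2n] := eqVneq k 2%N.
    by rewrite k2E /= /f -oS; [exact: Hy|lia].
  rewrite leNgt; apply/negP => fk1; have := kmin k.-1.
  by rewrite (ltW fk1) andbT; lia.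
have oSk : ordS (o k.-1) = o k by rewrite oS k1.
have o_neq i j : (i < n)%N -> (j < n)%N -> i <> j -> o i != o j.
  by move=> i_n jn ij; apply/eqP => /(congr1 val); rewrite !oE.
apply: (@triangle_convex _ _ (c (o 0)) (c (o k.-1)) (c (o k))) => //.
- exact: hull_convex.
- exact: corner_in_hull.
- exact: corner_in_hull.
- exact: corner_in_hull.
- have -> : cross (c (o k.-1) - c (o 0)) (c (o k) - c (o 0)) =
     cross (c (o k) - c (o k.-1)) (c (o 0) - c (o k.-1)).
    by rewrite /cross /=; ring.
  by rewrite -oSk; apply: ccw; rewrite ?oSk; apply: o_neq => //; lia.
- by rewrite -oSk.
Qed.

Lemma corner_inj : injective c.
Proof.
move=> i k cik; apply/eqP; apply: contraT => ik.
have [kS|kS] := eqVneq k (ordS i); last first.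
  by rewrite eq_sym in ik; have := ccw ik kS; rewrite cik /cross /=; lra.
have [m mi mS] := third_corner i.
by have := ccw mi mS; rewrite -kS cik /cross /=; lra.
Qed.

Lemma hull_interior y : (forall i, 0 < cross (side i) (y - c i)) -> P° y.
Proof.
move=> Hy; apply: (@filterS _ (nbhs y) _
    (fun z => forall i, 0 < cross (side i) (z - c i))).
  by move=> z Hz; apply/hullP => i; apply: ltW; apply: Hz.
apply: (@filter_forall _ _ (fun i z => 0 < cross (side i) (z - c i)) (nbhs y)).
move=> i; have /cvgr_gt := @continuous_cross R (side i) (c i) y.
by apply; exact: Hy.
Qed.

Definition transversal d := forall i, cross (side i) d != 0.

Lemma transversalN d : transversal d -> transversal (- d).
Proof. by move=> td i; rewrite crossNr oppr_eq0. Qed.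

(** An affine form that is nonnegative at both ends of a segment and not
    constant along it is positive in between. *)
Lemma open_ray_interior d x (e : R) : transversal d -> P x ->
  P (x + e *: d) -> forall e', 0 < e' < e -> P° (x + e' *: d).
Proof.
move=> td /hullP Px /hullP Pxe e' /andP[e'0 e'e].
apply: hull_interior => i; have := Pxe i; have := Px i.
rewrite !cross_shift => h1 h2.
have [h|h|h] := ltgtP 0 (cross (side i) d); last by have := td i; rewrite -h eqxx.
  by nra.
by nra.
Qed.

(** A side line through [x] would be crossed by the ray, so that one of the two
    steps would lead out of the polygon. *)
Lemma enters_both_interior d x : transversal d ->
  enters d P x -> enters (- d) P x -> P° x.
Proof.
move=> td [/hullP Px [e e0 /hullP Pe]] [_ [f f0 /hullP Pf]].
apply: hull_interior => i; have := Px i; have := Pe i; have := Pf i.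
rewrite !cross_shift crossNr => h1 h2 h3.
rewrite lt_def h3 andbT; apply/eqP => h0; have := td i; rewrite neq_lt.
by case/orP => h; nra.
Qed.

(** If every side line through [x] leaves [d] on its left, a short enough step
    in the direction [d] crosses no side line. *)
Lemma not_enters d x : P x -> ~ enters d P x ->
  exists i, cross (side i) (x - c i) = 0 /\ cross (side i) d < 0.
Proof.
move=> Px Nx; apply: contrapT => Nex; apply: Nx; split=> //.
have Hi i : cross (side i) (x - c i) = 0 -> 0 <= cross (side i) d.
  by move=> xi; rewrite leNgt; apply/negP => h; apply: Nex; exists i.
suff : \forall e \near 0^'+, 0 < e /\
    (forall i, 0 <= cross (side i) (x + e *: d - c i)).
  move=> near_e; have [e [e0 /hullP Pe]] := filter_ex near_e; by exists e.
near=> e; split; first by near: e; exact: nbhs_right_gt.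
near: e; apply: (@filter_forall _ _
  (fun i e => 0 <= cross (side i) (x + e *: d - c i)) 0^'+) => i.
have /hullP/(_ i) := Px; rewrite le_eqVlt => /orP[/eqP xi|xi].
  near=> e; rewrite cross_shift -xi add0r mulr_ge0 // Hi //.
have : (fun e => cross (side i) (x - c i) + e * cross (side i) d) @ 0^'+ -->
    cross (side i) (x - c i) + 0 * cross (side i) d.
  apply: cvgD; first exact: cvg_cst.
  by apply: cvgMl; apply: cvg_at_right_filter; exact: cvg_id.
rewrite mul0r addr0 => /cvgr_gt /(_ _ xi) near_e.
by near=> e; rewrite cross_shift ltW //; near: e.
Unshelve. all: by end_near. Qed.

(** At a corner that minimizes [cross d], each of the two adjacent side lines
    excludes one of the directions [d] and [- d]. *)
Lemma extreme_corner d : transversal d ->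
  exists k, [/\ forall y, P y -> 0 <= cross d (y - c k),
    ~ enters d P (c k) & ~ enters (- d) P (c k)].
Proof.
move=> td; pose i0 := Ordinal (ltnW (ltnW n3)).
case: (@Order.TotalTheory.arg_minP _ _ _ i0 xpredT (fun k => cross d (c k))) =>
  // k _ kmin.
exists k.
have ck j : 0 <= cross d (c j - c k) by rewrite crossBr subr_ge0 kmin.
split.
- move=> y Py; apply: (Py [set y | 0 <= cross d (y - c k)]).
  by split; [exact: halfplane_convex|move=> _ [j _ <-]; exact: ck].
- move=> [_ [e e0 /hullP/(_ k)]]; rewrite cross_shift.
  have := td k; have := ck (ordS k); rewrite -(opprK (cross d _)).
  have -> : - cross d (c (ordS k) - c k) = cross (side k) d.
    by rewrite /cross /=; ring.
  have -> : cross (side k) (c k - c k) = 0 by rewrite /cross /=; ring.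
  by rewrite neq_lt => h1 /orP[h2|h2]; nra.
- move=> [_ [e e0 /hullP/(_ (ord_pred k))]]; rewrite cross_shift crossNr ord_predK.
  have := td (ord_pred k); have := ck (ord_pred k); rewrite ord_predK.
  have -> : cross d (c (ord_pred k) - c k) = cross (c k - c (ord_pred k)) d.
    by rewrite /cross /=; ring.
  have -> : cross (c k - c (ord_pred k)) (c k - c (ord_pred k)) = 0.
    by rewrite /cross /=; ring.
  by rewrite neq_lt => h1 /orP[h2|h2]; nra.
Qed.

(** By Cramer's rule, [cross b a * cross y d] is a combination of [cross a y]
    and [cross b y] with negative coefficients, so that all three vanish. *)
Lemma cone_pointed (a b d y : plane) : cross b a != 0 ->
  cross a d < 0 -> 0 < cross b d -> 0 <= cross a y -> 0 <= cross b y ->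
  0 <= cross b a * cross y d -> y = 0.
Proof.
move=> D0 ad bd ay By.
have -> : cross b a * cross y d = cross a d * cross b y - cross b d * cross a y.
  by rewrite /cross; ring.
move=> h.
have ay0 : cross a y = 0 by nra.
have by0 : cross b y = 0 by nra.
have yE : cross b a *: y = cross b y *: a - cross a y *: b.
  by congr (_, _); rewrite /cross /= /GRing.scale /=; ring.
by apply: (scalerI D0); rewrite yE ay0 by0 !scale0r subr0 scaler0.
Qed.

(** Seen along a transversal direction [d], the boundary of a polygon consists
    of a near and a far chain, with just two points in common: the extreme
    ones for the linear form [cross d]. *)
Lemma blocked_corners d : transversal d -> exists p q,
  [/\ range c p, range c q, p != q &
    forall x, P x -> (~ enters d P x /\ ~ enters (- d) P x <-> x = p \/ x = q)].
Proof.
move=> td; have [k [kmin kd kNd]] := extreme_corner td.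
have [l [lmin ld lNd]] := extreme_corner (transversalN td).
rewrite opprK in lNd.
exists (c k), (c l); split; [by exists k|by exists l| |].
  apply/eqP => ckl; have := td k.
  have := kmin _ (corner_in_hull (ordS k)).
  have := lmin _ (corner_in_hull (ordS k)); rewrite -ckl.
  have -> : cross (- d) (side k) = cross (side k) d by rewrite /cross /=; ring.
  have -> : cross d (side k) = - cross (side k) d by rewrite /cross /=; ring.
  by rewrite neq_lt => {ckl} h1 h2 /orP[] h3; lra.
move=> x Px; split=> [[xd xNd]|[]->//].
have [i [xi di]] := not_enters Px xd; have [j [xj]] := not_enters Px xNd.
rewrite crossNr oppr_lt0 => dj.
have Pi z : P z -> 0 <= cross (side i) (z - x).
  by move=> /hullP/(_ i); rewrite (cross_via x) xi addr0.
have Pj z : P z -> 0 <= cross (side j) (z - x).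
  by move=> /hullP/(_ j); rewrite (cross_via x) xj addr0.
have [D|D|D] := ltgtP (cross (side j) (side i)) 0.
- right; apply/esym/eqP; rewrite -subr_eq0; apply/eqP.
  apply: (@cone_pointed (side i) (side j) d) => //; rewrite ?lt_eqF //.
  + exact: (Pi _ (corner_in_hull _)).
  + exact: (Pj _ (corner_in_hull _)).
  + apply: mulr_le0; first exact: ltW.
    by have := lmin _ Px; rewrite /cross /=; lra.
- left; apply/esym/eqP; rewrite -subr_eq0; apply/eqP.
  apply: (@cone_pointed (side i) (side j) d) => //; rewrite ?gt_eqF //.
  + exact: (Pi _ (corner_in_hull _)).
  + exact: (Pj _ (corner_in_hull _)).
  + apply: mulr_ge0; first exact: ltW.
    by have := kmin _ Px; rewrite /cross /=; lra.
- have [m mi mSi] := third_corner i.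
  have ccwm : 0 < cross (side i) (c m - x).
    by have := ccw mi mSi; rewrite (cross_via x) xi addr0.
  have jm := Pj _ (corner_in_hull m).
  have : cross (side j) (side i) * cross (c m - x) d =
     cross (side i) d * cross (side j) (c m - x) -
     cross (side j) d * cross (side i) (c m - x).
    by rewrite /cross; ring.
  by rewrite D mul0r => h; exfalso; nra.
Qed.

Lemma ordS_neq (i : 'I_n) : ordS i != i.
Proof.
by apply/eqP => /(congr1 val); rewrite ordS_val /=; case: eqP; lia.
Qed.

Lemma ordSS_neq (i : 'I_n) : ordS (ordS i) != i.
Proof.
apply/eqP => /(congr1 val); rewrite !ordS_val /=.
by case: (i.+1 =P n) => iS; case: eqP => /=; lia.
Qed.

(** An angle less than pi at the corner makes the midpoint of two points that
    lie beyond its two sides fall inside the polygon. *)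
Lemma corner_wedge i : exists u v, forall t : R, 0 < t < 1 ->
  [/\ ~ P (c i + t *: u), ~ P (c i + t *: v) &
      P° (c i + (t / 2) *: (u + v))].
Proof.
set j := ord_pred i; have ji : ordS j = i by exact: ord_predK.
pose a := side i; pose b := c j - c i.
exists (a + a - b), (b + b - a) => t /andP[t0 t1].
have iSj : ordS i != j by rewrite -{1}ji ordSS_neq.
have ab : 0 < cross a b.
  by apply: ccw; [rewrite -ji eq_sym ordS_neq|rewrite eq_sym].
split.
- move=> /hullP/(_ i); rewrite cross_shift -/a.
  have -> : cross a (a + a - b) = - cross a b by rewrite /cross /=; ring.
  have -> : cross a (c i - c i) = 0 by rewrite /cross /=; ring.
  by nra.
- move=> /hullP/(_ j); rewrite cross_shift ji.
  have -> : cross (c i - c j) (b + b - a) = - cross a b.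
    by rewrite /b /cross /=; ring.
  have -> : cross (c i - c j) (c i - c j) = 0 by rewrite /cross /=; ring.
  by nra.
- apply: hull_interior => k.
  have -> : cross (side k) (c i + (t / 2) *: (a + a - b + (b + b - a)) - c k) =
     (1 - t) * cross (side k) (c i - c k) +
     t / 2 * cross (side k) (c (ordS i) - c k) +
     t / 2 * cross (side k) (c j - c k).
    by rewrite /a /b /cross /= /GRing.scale /=; field.
  have h1 := cross_side_ge0 k i; have h2 := cross_side_ge0 k (ordS i).
  have h3 := cross_side_ge0 k j.
  have t2 : 0 < t / 2 by lra.
  suff : [|| 0 < cross (side k) (c i - c k),
     0 < cross (side k) (c (ordS i) - c k) | 0 < cross (side k) (c j - c k)].
    by case/or3P => h; nra.
  have [ik|ik] := eqVneq i k.
    by apply/or3P/Or33; apply: ccw; rewrite -?ik // eq_sym -?ji ?ordS_neq // ji.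
  have [iSk|iSk] := eqVneq i (ordS k); last by apply/or3P/Or31/ccw.
  apply/or3P/Or32/ccw; last by rewrite iSk ordS_neq.
  have jk : j = k by apply: (can_inj (@ordSK n)); rewrite ji.
  by rewrite -jk.
Qed.

End Ngon.

(** * Tiles and vertices of a normal tiling *)

Section Tiles.
Context {R : realType} {n : nat}.
Local Notation plane := (R * R)%type.
Implicit Types (S T : set plane) (x y d : plane) (e r : R).
Context {Tl : set (set plane)} {delta diam : R}.
(* The two disks that normality provides for a tile, in terms of the max norm:
   [delta] comes from the inner one and [diam] from the outer one. *)
Hypothesis n3 : (3 <= n)%N.
Hypothesis ngon : forall T, Tl T -> convex_ngon n T.
Hypothesis tilingT : tiling Tl.
Hypothesis delta0 : 0 < delta.
Hypothesis thick : forall T, Tl T -> exists a : plane, ball a delta `<=` T.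
Hypothesis diam0 : 0 < diam.
Hypothesis small : forall T x y, Tl T -> T x -> T y -> ball x diam y.

Lemma tile_convex T : Tl T -> convex_set T.
Proof. by move=> /ngon[c [_ ->]]; exact: hull_convex. Qed.

(** A convex tile is the closure of its interior, so the interior of [S] meets
    every neighborhood of [x]. *)
Lemma tile_eq_interior S T x : Tl S -> Tl T -> S x -> T° x -> S = T.
Proof.
move=> TlS TlT Sx Tx; apply: contrapT => ST.
have [_ _ /(_ _ _ TlS TlT ST) ST0] := tilingT.
have [a aS] := thick TlS.
have near_s : \forall s \near 0^'+, 0 < s <= 1 /\ T° (x + s *: (a - x)).
  apply: filterI; last by apply: near_ray; exact: nbhs_interior.
  near=> s; apply/andP; split; first by near: s; exact: nbhs_right_gt.
  by near: s; apply: nbhs_right_le.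
have [s [s01 Ts]] := filter_ex near_s.
have : (S° `&` T°) (x + s *: (a - x)).
  split=> //; apply: convex_interior aS _ _ _ => //; exact: tile_convex.
by rewrite ST0.
Unshelve. all: by end_near. Qed.

Definition packing_bound r : nat := (Num.trunc (2 * r / delta)).+1 ^ 2.

(** Each tile contains a box of half-side [delta]. If the centers of the boxes of
    two tiles lie in the same cell of a grid of mesh [delta], then each of them
    is interior to the other tile. So the tiles are at most as many as the
    cells. *)
Lemma packing x r (F : set (set plane)) : F `<=` Tl ->
  (forall T, F T -> T `<=` ball x r) -> (F #<= `I_(packing_bound r))%card.
Proof.
move=> FT Fx.
pose ctr (T : set plane) := get [set a | ball a delta `<=` T].
have ctrP T : F T -> ball (ctr T) delta `<=` T.
  move=> /FT/thick; exact: (@getPex _ [set a | ball a delta `<=` T]).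
set m := (Num.trunc (2 * r / delta)).+1.
pose g (s : R) := Num.trunc ((s + r) / delta).
have gm (s t : R) : `|t - s| < r -> (g (s - t)%R < m)%N.
  move=> str; rewrite ltnS /g.
  apply: le_truncn; rewrite ler_pM2r ?invr_gt0 //.
  by move: str; rewrite ltr_norml; lra.
have g_inj (s t w : R) : `|w - s| < r -> `|w - t| < r -> g (s - w) = g (t - w) ->
    `|s - t| < delta.
  move=> ws wt gst.
  have h (z : R) : `|w - z| < r ->
      (g (z - w))%:R * delta <= z - w + r < (g (z - w)).+1%:R * delta.
    move=> wz; rewrite -ler_pdivlMr // -ltr_pdivrMr //.
    by apply: truncn_itv; rewrite divr_ge0 ?ltW //; move: wz; rewrite ltr_norml; lra.
  have := h _ ws; have := h _ wt; rewrite gst -natr1 mulrDl mul1r ltr_norml.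
  by lra.
pose code T := (g ((ctr T).1 - x.1)%R * m + g ((ctr T).2 - x.2)%R)%N.
have ctrx T : F T -> `|x.1 - (ctr T).1| < r /\ `|x.2 - (ctr T).2| < r.
  by move=> TF; apply/ballP; apply: (Fx _ TF); apply: (ctrP _ TF); exact: ballxx.
apply: (@card_le_inj _ _ code) => [T TF|S T].
  rewrite /= /code /packing_bound -/m.
  have [/gm h1 /gm h2] := ctrx _ TF; nia.
rewrite !inE /code => SF TF cST.
have [S1 S2] := ctrx _ SF; have [T1 T2] := ctrx _ TF.
have [g1 g2] : g ((ctr S).1 - x.1) = g ((ctr T).1 - x.1) /\
    g ((ctr S).2 - x.2) = g ((ctr T).2 - x.2).
  have := gm _ _ S2; have := gm _ _ T2.
  move=> gT gS; have := congr1 (edivn^~ m) cST.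
  by rewrite !edivn_eq // => -[-> ->].
apply: (@tile_eq_interior _ _ (ctr S)).
- exact: FT.
- exact: FT.
- by apply: (ctrP _ SF); exact: ballxx.
- apply: (@filterS _ (nbhs (ctr S)) _ (ball (ctr T) delta)); first exact: ctrP.
  apply: open_nbhs_nbhs; split; first exact: ball_open.
  by apply/ballP; split; [apply: g_inj (T1) (S1) _|apply: g_inj (T2) (S2) _].
Qed.

Definition meeting (A : set plane) : set (set plane) :=
  [set T | Tl T /\ T `&` A !=set0].

Lemma meeting_ball x r T : meeting (ball x r) T -> T `<=` ball x (r + diam).
Proof.
move=> [TlT [y [Ty xy]]] z Tz; apply: ball_triangle xy _.
exact: small TlT Ty Tz.
Qed.

Lemma card_meeting_ball x r :
  (meeting (ball x r) #<= `I_(packing_bound (r + diam)))%card.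
Proof.
apply: (@packing x) => [T []//|T]; exact: meeting_ball.
Qed.

Lemma card_tiles_at x : (tiles_at Tl x #<= `I_(packing_bound diam))%card.
Proof.
apply: (@packing x) => [T []//|T [TlT Tx] y Ty]; exact: small TlT Tx Ty.
Qed.

(** Only finitely many tiles come near [x], and those that avoid [x] are closed,
    hence avoid a neighborhood of [x]. *)
Lemma locally_at x :
  \forall y \near x, forall T, Tl T -> T y -> T x.
Proof.
pose F := meeting (ball x 1).
have finF : finite_set F by apply: finite_le_II; exact: card_meeting_ball.
have : \forall y \near x, forall T : fset_set F, val T y -> val T x.
  apply: (@filter_forall _ _ (fun (T : fset_set F) y => val T y -> val T x)
    (nbhs x)).
  move=> [T /=]; rewrite in_fset_set // inE => -[TlT _].
  have [Tx|nTx] := pselect (T x); first by apply: nearW.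
  have [cl _ _] := tilingT.
  have : open (~` T) by apply: closed_openC; exact: cl.
  move=> oT; have : nbhs x (~` T) by apply: open_nbhs_nbhs.
  by apply: filterS => y nTy /nTy.
move=> near_x; near=> y => T TlT Ty.
have TF : T \in fset_set F.
  rewrite in_fset_set // inE; split=> //; exists y; split=> //.
  by near: y; exact: nbhsx_ballx.
have /(_ [` TF]%fset Ty) : forall T : fset_set F, val T y -> val T x by near: y.
by [].
Unshelve. all: by end_near. Qed.

(** Just beyond the two sides at the corner lie points of other tiles. These two
    tiles are distinct: a convex tile that contains both points contains their
    midpoint, which is interior to the tile of the corner. *)
Lemma corner_vertex (c : 'I_n -> plane) i : counterclockwise c ->
  Tl (convex_hull (range c)) -> vertices Tl (c i).
Proof.
move=> ccw TlT; set T := convex_hull (range c) in TlT *.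
have [u [v uv]] := corner_wedge n3 ccw i.
have near_s : \forall s \near (0 : R)^'+, 0 < s < 1.
  near=> s; apply/andP; split; near: s; [exact: nbhs_right_gt|exact: nbhs_right_lt].
have near_w (w : plane) := near_ray w (locally_at (c i)).
have [s [s01 [su sv]]] := filter_ex (filterI near_s (filterI (near_w u) (near_w v))).
have [Tu Tv Tuv] := uv _ s01.
have [_ cov _] := tilingT.
have [S1 TlS1 S1u] : (\bigcup_(T in Tl) T) (c i + s *: u) by rewrite cov.
have [S2 TlS2 S2v] : (\bigcup_(T in Tl) T) (c i + s *: v) by rewrite cov.
apply/three_elements; exists T, S1, S2; split; split.
- by split=> //; exact: corner_in_hull.
- by split=> //; exact: su S1u.
- by split=> //; exact: sv S2v.
- by move=> TS; rewrite -TS in S1u.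
- move=> S12; rewrite -S12 in S2v; apply: Tu; rewrite -/T.
  suff <- : S1 = T by [].
  apply: tile_eq_interior Tuv => //.
  have -> : c i + s / 2 *: (u + v) =
     2^-1 *: (c i + s *: u) + (1 - 2^-1) *: (c i + s *: v).
    by congr (_, _); rewrite /= /GRing.scale /=; field.
  by apply: convex_segment => //; [exact: tile_convex|lra].
- by move=> TS; rewrite -TS in S2v.
Unshelve. all: by end_near. Qed.

Lemma vertex_not_interior x T : vertices Tl x -> Tl T -> ~ T° x.
Proof.
move=> /three_elements[S1 [S2 [S3 [[[TlS1 S1x] [TlS2 S2x] _] [S12 _ _]]]]] TlT Tx.
apply: S12; rewrite (tile_eq_interior TlS1 TlT S1x Tx).
by rewrite (tile_eq_interior TlS2 TlT S2x Tx).
Qed.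

Lemma countable_tiles : countable Tl.
Proof.
pose F (k : nat) := meeting (ball (0 : plane) k%:R).
apply: (@sub_countable _ _ _ (\bigcup_k F k)); last first.
  apply: bigcup_countable => // k _; apply: finite_set_countable.
  apply: finite_le_II; exact: card_meeting_ball.
apply: subset_card_le => T TlT; have [a aT] := thick TlT.
exists (Num.trunc (Num.max `|a.1| `|a.2|)).+1 => //.
split=> //; exists a; split; first by apply: aT; exact: ballxx.
apply/ballP; rewrite /= !sub0r !normrN.
by split; apply: le_lt_trans (truncnS_gt _); rewrite le_max lexx ?orbT.
Qed.

Definition generic d (C : set plane -> 'I_n -> plane) := forall T, Tl T ->
  [/\ counterclockwise (C T), T = convex_hull (range (C T)) &
      transversal (c := C T) d].

(** Only countably many slopes are those of sides of tiles. *)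
Lemma generic_direction : exists d C, generic d C.
Proof.
pose C T := get [set c : 'I_n -> plane | counterclockwise c /\
  T = convex_hull (range c)].
have CP T : Tl T -> counterclockwise (C T) /\ T = convex_hull (range (C T)).
  move=> /ngon; exact: (@getPex _ [set c : 'I_n -> plane | counterclockwise c /\
    T = convex_hull (range c)]).
pose side T i := C T (ordS i) - C T i.
pose B := \bigcup_(T in Tl) \bigcup_(i in [set: 'I_n])
   [set (side T i).1 / (side T i).2].
have cB : countable B.
  apply: bigcup_countable; first exact: countable_tiles.
  move=> T _; apply: bigcup_countable => [|i _]; last exact: countable1.
  exact: finite_set_countable.
have [m mB] : exists m, ~ B m.
  apply: contrapT => nB.
  have : lebesgue_measure [set` `[(0 : R), 1]] = 0%E.
    apply: countable_lebesgue_measure0; apply: sub_countable cB.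
    by apply: subset_card_le => m _; apply: contrapT => mB; apply: nB; exists m.
  by rewrite lebesgue_measure_itv /= lte01 sube0 => /eqP; rewrite onee_eq0.
exists (m, 1), C => T TlT; have [ccw TE] := CP _ TlT; split=> // i.
rewrite /cross /= mulr1; apply/eqP => sm.
(* A horizontal side is not parallel to [(m, 1)], whatever value the quotient
   by 0 takes in [B]. *)
have [s2|s2] := eqVneq (side T i).2 0.
  have /eqP := ordS_neq n3 i; apply; apply: (corner_inj n3 ccw).
  apply/eqP; rewrite -subr_eq0; apply/eqP; congr (_, _); last exact: s2.
  by move: sm; rewrite -/(side T i) [X in X * m]s2 mul0r subr0.
apply: mB; exists T => //; exists i => //=.
by rewrite -/(side T i) (subr0_eq sm) mulrC mulKf.
Qed.

Lemma genericN d C : generic d C -> generic (- d) C.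
Proof. by move=> gen T /gen[ccw TE td]; split=> //; exact: transversalN. Qed.

(** From [x], the ray first runs in the interior of both tiles. *)
Lemma enters_unique d C S T x : generic d C -> Tl S -> Tl T ->
  enters d S x -> enters d T x -> S = T.
Proof.
move=> gen TlS TlT [Sx [e e0 Se]] [Tx [f f0 Tf]].
pose g := Num.min e f.
have [g0 ge gf] : [/\ 0 < g, g <= e & g <= f].
  by rewrite lt_min e0 f0 ge_min lexx ge_min lexx orbT.
apply: (@tile_eq_interior _ _ (x + (g / 2) *: d)) => //.
  by apply: (entersW (tile_convex TlS) Sx e0 Se); lra.
have [ccw TE td] := gen _ TlT; rewrite TE in Tx Tf *.
by apply: (open_ray_interior n3 ccw td Tx Tf); lra.
Qed.

Lemma enters_one d C T x : generic d C -> Tl T -> vertices Tl x ->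
  enters d T x -> ~ enters (- d) T x.
Proof.
move=> gen TlT Vx ex eNx; apply: (vertex_not_interior Vx TlT).
have [ccw TE td] := gen _ TlT; rewrite TE in ex eNx *.
exact: (enters_both_interior n3 ccw td ex eNx).
Qed.

(** If a point is a corner of none of its tiles, each of them is entered by one
    of two opposite rays; each ray enters at most one tile, so at most two tiles
    meet there. *)
Lemma vertex_corner d C x : generic d C -> vertices Tl x ->
  exists T i, [/\ Tl T, T x & x = C T i].
Proof.
move=> gen Vx; apply: contrapT => nocorner.
have ent T : tiles_at Tl x T -> enters d T x \/ enters (- d) T x.
  move=> [TlT Tx]; apply: contrapT => /not_orP nent.
  have [ccw TE td] := gen _ TlT.
  have [p [q [[i _ pE] [j _ qE] _ pq]]] := blocked_corners n3 ccw td.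
  rewrite -TE in pq; have [] := (pq _ Tx).1 nent => xE; apply: nocorner.
    by exists T, i; rewrite pE.
  by exists T, j; rewrite qE.
have genN := genericN gen.
have [S1 [S2 [S3 [[T1 T2 T3] [S12 S23 S13]]]]] := (three_elements _).1 Vx.
have un := enters_unique gen; have unN := enters_unique genN.
have [T1l _] := T1; have [T2l _] := T2; have [T3l _] := T3.
case: (ent _ T1) => h1; case: (ent _ T2) => h2; case: (ent _ T3) => h3;
  first [ by apply: S12; apply: (un _ _ x) | by apply: S23; apply: (un _ _ x)
  | by apply: S13; apply: (un _ _ x) | by apply: S12; apply: (unN _ _ x)
  | by apply: S23; apply: (unN _ _ x) | by apply: S13; apply: (unN _ _ x)].
Qed.

Definition vertex_bound r : nat := (packing_bound (r + diam) * n)%N.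

Lemma card_vertices_ball x r :
  (vertices Tl `&` ball x r #<= `I_(vertex_bound r))%card.
Proof.
have [d [C gen]] := generic_direction.
pose A := meeting (ball x r) `*` [set: 'I_n].
have sub : vertices Tl `&` ball x r `<=` [set C p.1 p.2 | p in A].
  move=> y [Vy xy]; have [T [i [TlT Ty yE]]] := vertex_corner gen Vy.
  by exists (T, i) => //; split=> //; split=> //; exists y.
apply: card_le_trans (subset_card_le sub) _.
apply: card_le_trans (card_image_le _ _) _.
have /pcard_leP[f] := @card_meeting_ball x r.
pose code (p : set plane * 'I_n) := (f p.1 * n + p.2)%N.
apply: (@card_le_inj _ _ code) => [[T i] [TF _]|[T i] [S j]]; rewrite /code /=.
  have fT : (f T < packing_bound (r + diam))%N by exact: (@funS _ _ _ _ f _ TF).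
  apply: (@leq_trans ((f T).+1 * n)); last by rewrite leq_mul2r fT orbT.
  by rewrite mulSn addnC ltn_add2r.
rewrite !inE => -[TF _] [SF _] fTS.
have := congr1 (edivn^~ n) fTS; rewrite !edivn_eq // => -[fE /val_inj ->].
by rewrite (inj _ _ fE) ?inE.
Qed.

(** * Patches *)

(** A tile that meets the disk without being contained in it crosses the
    circle. *)
Lemma patch_meets r M T x : 0 < r -> Tl T -> T x -> disk r M x ->
  Defs.patch Tl r M T.
Proof.
move=> r0 TlT Tx rx; left.
have [Tr|nTr] := pselect (T `<=` disk r M); first by left.
right; split=> //.
have [y [Ty ry]] : exists y, T y /\ ~ disk r M y.
  apply: contrapT => nex; apply: nTr => y Ty.
  by apply: contrapT => ry; apply: nex; exists y.
pose g (t : R) : R :=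
  (x.1 + t * (y.1 - x.1) - M.1) ^+ 2 + (x.2 + t * (y.2 - x.2) - M.2) ^+ 2.
have cg : {within `[0, 1], continuous g}.
  apply: continuous_subspaceT => t; rewrite /g.
  have cl (a b c : R) : {for t, continuous (fun t : R => (a + t * b - c) ^+ 2)}.
    apply: (@continuous_comp _ _ _ (fun t : R => a + t * b - c) (fun z : R => z ^+ 2));
      last exact: exprn_continuous.
    apply: cvgB; last exact: cvg_cst.
    apply: cvgD; first exact: cvg_cst.
    by apply: cvgMl; exact: cvg_id.
  by apply: cvgD; exact: cl.
have g0 : g 0 <= r ^+ 2 by rewrite /g !mul0r !addr0; apply/diskP => //; exact: ltW.
have g1 : r ^+ 2 <= g 1.
  rewrite leNgt; apply/negP => g1; apply: ry; apply/diskP; first exact: ltW.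
  move: g1; rewrite /g !mul1r ![_ + (_ - _)]addrC !subrK; exact: ltW.
have [|t t01 gt] := IVT (v := r ^+ 2) ler01 cg.
  by rewrite ge_min g0 le_max g1 orbT.
exists (x + t *: (y - x)); split; last exact: boundary_disk.
have -> : x + t *: (y - x) = t *: y + (1 - t) *: x.
  by apply: plane_eq; rewrite /= /GRing.scale /=; ring.
by apply: convex_segment => //; exact: tile_convex.
Qed.

(** The rim lies within [2 + 2 * diam] of the disk: 1 for a point of the disk
    close to the given boundary point and [diam] for the tile, both doubled by
    [disk_ball]. A second [2 * diam] covers an enclosed tile around one of its
    points. *)
Definition patch_margin : R := 2 + 4 * diam.

(** An enclosed tile cannot reach farther out than the rim: the ray issued from
    one of its interior points away from the center would miss the rim and be
    unbounded. *)
Lemma patch_near r M T : 0 < r -> Defs.patch Tl r M T ->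
  Tl T /\ T `<=` disk (r + patch_margin) M.
Proof.
move=> r0.
have disk_le (s t : R) : s <= t -> disk s M `<=` disk t M.
  by move=> st x /= /le_trans; apply.
have grow S x (s : R) : Tl S -> S x -> 0 <= s -> disk s M x ->
    S `<=` disk (s + 2 * diam) M.
  by move=> TlS Sx s0 sx y Ty; apply: (disk_ball s0 sx); exact: (small TlS).
have rim_near S : rim_tiles Tl r M S -> Tl S /\ S `<=` disk (r + 2 + 2 * diam) M.
  move=> [TlS [x [Sx [rx _]]] _]; split=> //.
  have [z [rz xz]] := rx _ (nbhsx_ballx x 1 ltr01).
  apply: (grow _ x) => //; first by lra.
  have := disk_ball (ltW r0) rz (ball_sym xz); by rewrite mulr1.
rewrite /patch_margin.
move=> [[[TlT Tr]|/rim_near[TlT Tr]]|[TlT [x [_ bC TC]] _]]; split=> //.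
- by move=> y /Tr; apply: disk_le; have := diam0; lra.
- by move=> y /Tr; apply: disk_le; have := diam0; lra.
have [a aT] := thick TlT.
have Ta : T a by apply: aT; exact: ballxx.
suff ra : disk (r + 2 + 2 * diam) M a.
  have -> : r + (2 + 4 * diam) = r + 2 + 2 * diam + 2 * diam by ring.
  by apply: (grow _ a) => //; have := diam0; lra.
apply: contrapT => nra.
set X := \bigcup_(S in rim_tiles Tl r M) S in bC TC.
have q0 : 0 <= r + 2 + 2 * diam by have := diam0; lra.
pose ray (s : R) := M + s *: (a - M).
have raya : ray 1 = a by rewrite /ray scale1r addrC subrK.
have ray_con : connected (ray @` `[1, +oo[).
  apply: connected_continuous_connected.
    by apply/connected_intervalP; exact: interval_is_interval.
  apply: continuous_subspaceT; exact: continuous_ray.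
have ray_out : ray @` `[1, +oo[ `<=` ~` X.
  move=> z [s s_itv <-] [S /rim_near[_ Sr] /Sr].
  have s1 : 1 <= s by move: s_itv; rewrite /= in_itv /= andbT.
  move=> /(diskP _ _ q0) h; apply: nra; apply/(diskP _ _ q0).
  apply: le_trans h; rewrite /ray /= /GRing.scale /=.
  have -> : (M.1 + s * (a.1 - M.1) - M.1) ^+ 2 + (M.2 + s * (a.2 - M.2) - M.2) ^+ 2 =
      s ^+ 2 * ((a.1 - M.1) ^+ 2 + (a.2 - M.2) ^+ 2) by ring.
  by rewrite ler_peMl ?addr_ge0 ?sqr_ge0 // expr_ge1 // (le_trans ler01).
have Ca : connected_component (~` X) x a.
  by apply: TC; apply: filterS aT _; exact: nbhsx_ballx.
have rayC : ray @` `[1, +oo[ `<=` connected_component (~` X) x.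
  rewrite (same_connected_component Ca); apply: connected_component_max => //.
  by exists 1; rewrite //= in_itv /= lexx.
have aM : 0 < `|a - M|.
  rewrite normr_gt0 subr_eq0; apply/eqP => aM; apply: nra; apply/(diskP _ _ q0).
  by rewrite aM !subrr expr0n /= addr0 sqr_ge0.
have [K K0 bK] := pinfty_ex_gt0 bC.
pose s := (K + `|M| + 1) / `|a - M| + 1.
have s1 : 1 <= s.
  rewrite /s lerDr; apply: divr_ge0; last exact: ltW.
  by rewrite addr_ge0 // addr_ge0 // ltW.
have Cs : connected_component (~` X) x (ray s).
  by apply: rayC; exists s; rewrite //= in_itv /= andbT.
have := bK _ Cs => /= h.
have : `|s *: (a - M)| <= K + `|M|.
  have -> : s *: (a - M) = ray s - M by rewrite /ray [M + _]addrC addrK.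
  by apply: le_trans (ler_normB _ _) _; rewrite lerD2r.
rewrite normrZ ger0_norm ?(le_trans ler01) // /s mulrDl mul1r divfK ?gt_eqF //.
apply/negP; rewrite -ltNge -addrA ltrDl.
by rewrite addr_gt0.
Qed.

Lemma finite_patch r M : 0 < r -> finite_set (Defs.patch Tl r M).
Proof.
move=> r0; have c0 : 0 <= r + patch_margin.
  by rewrite /patch_margin; have := diam0; lra.
apply: finite_le_II; apply: (@packing M (r + patch_margin + 1)).
- by move=> T /patch_near[].
- move=> T /patch_near[//|_] Tr x /Tr; exact: disk_sub_ball.
Qed.

Lemma patch_vertices_near r M : 0 < r ->
  patch_vertices Tl r M `<=` vertices Tl `&` disk (r + patch_margin) M.
Proof. by move=> r0 x [Vx [T /patch_near[//|_] Tr /Tr]]. Qed.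

Lemma vertices_disk_patch r M : 0 < r ->
  vertices Tl `&` disk r M `<=` patch_vertices Tl r M.
Proof.
move=> r0 x [Vx rx]; split=> //.
have [T [_ [_ [[[TlT Tx] _ _] _]]]] := (three_elements _).1 Vx.
by exists T => //; exact: patch_meets rx.
Qed.

Lemma card_vertices_disk r M : 0 <= r ->
  (vertices Tl `&` disk r M #<= `I_(vertex_bound (r + 1)))%card.
Proof.
move=> r0; apply: card_le_trans (card_vertices_ball M (r + 1)).
by apply: subset_card_le => x [Vx /(disk_sub_ball r0)].
Qed.

Lemma finite_patch_vertices r M : 0 < r -> finite_set (patch_vertices Tl r M).
Proof.
move=> r0; have c0 : 0 <= r + patch_margin.
  by rewrite /patch_margin; have := diam0; lra.
apply: (sub_finite_set (patch_vertices_near r0)).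
apply: finite_le_II; exact: card_vertices_disk.
Qed.

(** * Counting entrances *)

Definition entrances d T x : nat := `[< enters d T x >] + `[< enters (- d) T x >].

(** At every vertex of the tiling on the boundary of [T], except at the two
    corners where both rays are blocked, exactly one of the two rays enters [T].
    This stands for the angle sum [(k - 2) * pi] of a [k]-gon, where vertices
    inside a side count as corners with a straight angle. *)
Lemma sum_entrances d C T (Y : {fset plane}) : generic d C -> Tl T ->
  (forall x, x \in Y -> T x /\ vertices Tl x) -> (forall i, C T i \in Y) ->
  (\sum_(x <- Y) entrances d T x + 2 = #|` Y|)%N.
Proof.
move=> gen TlT TY CY; have [ccw TE td] := gen _ TlT.
have [p [q [[i _ pE] [j _ qE] pq pqP]]] := blocked_corners n3 ccw td.
rewrite -TE in pqP.
have pY : p \in Y by rewrite -pE.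
have qY : q \in Y by rewrite -qE.
rewrite -[2%N]/(1 + 1)%N -{1}(sum_pred1 pY) -(sum_pred1 qY) addnA -!big_split /=.
rewrite -sum1_size big_seq [RHS]big_seq; apply: eq_bigr => x xY.
have [Tx Vx] := TY _ xY; have one := enters_one gen TlT Vx.
have xpq := pqP _ Tx; rewrite /entrances.
case: asboolP => ex; case: asboolP => eNx.
- by have := one ex eNx.
- case: eqP => [xp|_]; first by have [] := xpq.2 (or_introl xp).
  by case: eqP => [xq|_]; first by have [] := xpq.2 (or_intror xq).
- case: eqP => [xp|_]; first by have [] := xpq.2 (or_introl xp).
  by case: eqP => [xq|_]; first by have [] := xpq.2 (or_intror xq).
- case: eqP => [xp|nxp]; case: eqP => [xq|nxq] //.
    by move: pq; rewrite -xp -xq eqxx.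
  by case: (xpq.1 (conj ex eNx)).
Qed.

Definition valence x : nat := #|` fset_set (tiles_at Tl x)|.

Lemma finite_tiles_at x : finite_set (tiles_at Tl x).
Proof. apply: finite_le_II; exact: card_tiles_at. Qed.

Lemma has_valenceP j x : has_valence Tl j x <-> valence x = j.
Proof.
split=> [/card_fset_set//|<-].
apply/fcard_eq; rewrite ?(card_fset_set (card_eqxx _)) //.
exact: finite_tiles_at.
Qed.

Lemma valence_ge3 x : vertices Tl x -> (3 <= valence x)%N.
Proof. by move=> Vx; apply: leq_card_fset_set => //; exact: finite_tiles_at. Qed.

Lemma valence_le x : (valence x <= packing_bound diam)%N.
Proof. apply: geq_card_fset_set; exact: card_tiles_at. Qed.

Section Patch.
Context {M : plane} {r : R}.
Hypothesis r0 : 0 < r.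
Local Notation F := (fset_set (Defs.patch Tl r M)).
Local Notation W := (fset_set (patch_vertices Tl r M)).

Lemma in_patch T : T \in F <-> Defs.patch Tl r M T.
Proof. by rewrite in_fset_set ?inE //; exact: finite_patch. Qed.

Lemma in_patch_vertices x : x \in W <-> patch_vertices Tl r M x.
Proof. by rewrite in_fset_set ?inE //; exact: finite_patch_vertices. Qed.

Lemma in_patch_tile T : T \in F -> Tl T.
Proof. by move=> /in_patch/(patch_near r0)[]. Qed.

Lemma corner_in_patch d C T i : generic d C -> T \in F -> C T i \in W.
Proof.
move=> gen TF; have TlT := in_patch_tile TF; have [ccw TE td] := gen _ TlT.
apply/in_patch_vertices; split.
  by apply: corner_vertex => //; rewrite -TE.
by exists T; [apply/in_patch|rewrite {1}TE; exact: corner_in_hull].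
Qed.

(** Each of the two rays at a vertex enters at most one tile; this stands for the
    full angle [2 * pi] at a vertex. *)
Lemma sum_patch_entrances d C : generic d C ->
  (\sum_(T <- F) \sum_(x <- W) entrances d T x <= 2 * #|` W|)%N.
Proof.
move=> gen; rewrite exchange_big /= mulnC -sum1_size big_distrl /=.
apply: leq_sum => x _; rewrite big_split /= -[(1 * 2)%N]/(1 + 1)%N.
apply: leq_add; apply: sum_le1 => S T /in_patch_tile TlS /in_patch_tile TlT
  /asboolP Sx /asboolP Tx.
  exact: enters_unique gen TlS TlT Sx Tx.
exact: enters_unique (genericN gen) TlS TlT Sx Tx.
Qed.

(** The corners of a tile account for [n - 2] entrances. *)
Lemma patch_corners : (n * #|` F| <= 2 * #|` W| + 2 * #|` F|)%N.
Proof.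
have [d [C gen]] := generic_direction.
apply: (@leq_trans (\sum_(T <- F) (\sum_(x <- W) entrances d T x + 2))); last first.
  rewrite big_split /= leq_add ?(sum_patch_entrances gen) //.
  by rewrite big_const_seq count_predT iter_addn_0.
rewrite mulnC -sum1_size big_distrl /= big_seq [X in (_ <= X)%N]big_seq.
apply: leq_sum => T TF; rewrite mul1n.
have TlT := in_patch_tile TF; have [ccw TE td] := gen _ TlT.
pose Y := [fset C T i | i : 'I_n]%fset.
have YE : #|` Y| = n by rewrite card_imfset ?size_enum_ord //=; exact: corner_inj n3 ccw.
have Yin i : C T i \in Y by apply/imfsetP; exists i.
rewrite -{1}YE -(sum_entrances gen TlT _ Yin); last first.
  move=> _ /imfsetP[i _ ->]; split.
    by rewrite {1}TE; exact: corner_in_hull.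
  by apply: corner_vertex => //; rewrite -TE.
rewrite leq_add2r; apply: leq_sum_fsubset.
by apply/fsubsetP => _ /imfsetP[i _ ->]; exact: corner_in_patch gen TF.
Qed.

(** All the tiles at a vertex in the disk are in the patch. *)
Lemma valence_patch x : x \in W -> disk r M x ->
  (valence x <= \sum_(T <- F) `[< T x >])%N.
Proof.
move=> xW rx; apply: (@leq_card_sum _ _ _ (fun T : set plane => `[< T x >])).
  apply/fsubsetP => T; rewrite in_fset_set ?inE; last exact: finite_tiles_at.
  by move=> [TlT Tx]; apply/in_patch; exact: patch_meets rx.
move=> T; rewrite in_fset_set ?inE; last exact: finite_tiles_at.
by case.
Qed.

Definition disk_vertices s : {fset plane} := fset_set (vertices Tl `&` disk s M).

Lemma in_disk_vertices s x : 0 <= s ->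
  x \in disk_vertices s <-> vertices Tl x /\ disk s M x.
Proof.
move=> s0; have fin := finite_le_II (card_vertices_disk M s0).
by rewrite /disk_vertices in_fset_set ?inE.
Qed.

(** A tile with [k] vertices accounts for [k - 2] entrances, so the incidences
    between vertices and tiles of the patch exceed the entrances by twice the
    number of tiles. Only at the vertices outside the disk can these incidences
    fall short of the valences; [packing_bound diam] bounds the loss
    at each of them. *)
Lemma sum_valence :
  (\sum_(x <- W) valence x + packing_bound diam * #|` disk_vertices r| <=
   2 * #|` W| + 2 * #|` F| + packing_bound diam * #|` W|)%N.
Proof.
have [d [C gen]] := generic_direction.
have incE : (\sum_(T <- F) \sum_(x <- W) `[< T x >] =
    \sum_(T <- F) \sum_(x <- W) entrances d T x + 2 * #|` F|)%N.
  rewrite mulnC -sum1_size big_distrl -big_split /= big_seq [RHS]big_seq.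
  apply: eq_bigr => T TF; rewrite mul1n; have TlT := in_patch_tile TF.
  pose Y := [fset x in W | `[< T x >]]%fset.
  have YW : (Y `<=` W)%fset by apply/fsubsetP => x; rewrite !inE => /andP[].
  have YT x : x \in Y -> T x /\ vertices Tl x.
    by rewrite !inE => /andP[/in_patch_vertices[Vx _] /asboolP].
  have CY i : C T i \in Y.
    rewrite !inE (corner_in_patch _ gen TF); apply/asboolP.
    by have [_ TE _] := gen _ TlT; rewrite {1}TE; exact: corner_in_hull.
  have out x : x \in W -> x \notin Y -> ~ T x.
    by rewrite !inE => -> /= /asboolP.
  transitivity #|` Y|.
    rewrite -sum1_size -(big_fset_incl _ YW); last first.
      by move=> x xW /(out _ xW) nT; rewrite asboolF.
    by rewrite big_seq [RHS]big_seq; apply: eq_bigr => x /YT[Tx _]; rewrite asboolT.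
  rewrite -(sum_entrances gen TlT YT CY) (big_fset_incl _ YW) // => x xW.
  by move=> /(out _ xW) nT; rewrite /entrances !asboolF // => -[].
have disk_le : (#|` disk_vertices r| <= \sum_(x <- W) `[< disk r M x >])%N.
  have r_ge0 := ltW r0; apply: (@leq_card_sum _ _ _ (fun x : plane => `[< disk r M x >])).
    apply/fsubsetP => x /(in_disk_vertices _ r_ge0) Vx.
    by apply/in_patch_vertices; exact: vertices_disk_patch.
  by move=> x /(in_disk_vertices _ r_ge0)[_ rx]; apply/asboolP.
apply: (@leq_trans (\sum_(x <- W) (\sum_(T <- F) `[< T x >] + packing_bound diam))%N).
  apply: leq_trans (leq_add (leqnn _) (leq_mul (leqnn _) disk_le)) _.
  rewrite big_distrr -big_split /= big_seq [X in (_ <= X)%N]big_seq.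
  apply: leq_sum => x xW; case: asboolP => rx.
    by rewrite muln1 leq_add2r valence_patch.
  by rewrite muln0 addn0 (leq_trans (valence_le x)) // leq_addl.
rewrite big_split /= big_const_seq count_predT iter_addn_0 leq_add2r.
rewrite exchange_big incE leq_add2r; exact: sum_patch_entrances gen.
Qed.

End Patch.

(** * The margin of the patches *)

Section Growth.
Context {M : plane}.
Local Notation t r := (t_ Tl r M).
Local Notation v r := (v_ Tl r M).
Local Notation a r := (#|` @disk_vertices M r|%:R : R).
Local Notation N := (packing_bound diam).

Lemma t_gt0 r : 0 < r -> 0 < t r.
Proof.
move=> r0; rewrite ltr0n cardfs_gt0; apply/fset0Pn.
have [_ cov _] := tilingT.
have [T TlT TM] : (\bigcup_(T in Tl) T) M by rewrite cov.
exists T; apply/(in_patch r0); apply: (patch_meets r0 TlT TM).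
by apply/(diskP _ _ (ltW r0)); rewrite !subrr expr0n /= addr0 sqr_ge0.
Qed.

Lemma le_t_v r : 0 < r -> (n%:R - 2) * t r <= 2 * v r.
Proof.
move=> r0; have := @patch_corners M r r0.
by rewrite -(ler_nat R) natrD !natrM /t_ /v_ /ncard; lra.
Qed.

Lemma v_gt0 r : 0 < r -> 0 < v r.
Proof.
move=> r0; have := le_t_v r0; have := t_gt0 r0.
have : (3 : R) <= n%:R by rewrite ler_nat.
by nra.
Qed.

Lemma v_le_disk r : 0 < r -> v r <= a (r + patch_margin).
Proof.
move=> r0; have c0 : 0 <= r + patch_margin by rewrite /patch_margin; have := diam0; lra.
rewrite ler_nat; apply: fsubset_leq_card; apply/fsubsetP => x.
move=> /(in_patch_vertices r0)/(patch_vertices_near r0) h.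
by apply/(in_disk_vertices _ c0).
Qed.

Lemma disk_le_v r : 0 < r -> a r <= v r.
Proof.
move=> r0; rewrite ler_nat; apply: fsubset_leq_card; apply/fsubsetP => x.
move=> /(in_disk_vertices _ (ltW r0)) h.
by apply/(in_patch_vertices r0); exact: vertices_disk_patch.
Qed.

(** Every vertex is a corner of some tile, and the tiles that meet the disk are
    packed in a slightly larger box. *)
Lemma quadratic_growth : exists A B : R, [/\ 0 <= A, 0 <= B &
  forall r, 0 <= r -> a r <= (A + B * r) ^+ 2].
Proof.
exists (n%:R * (2 * (1 + diam) / delta + 1)), (n%:R * (2 / delta)).
have d0 := diam0; have e0 : 0 <= delta^-1 by rewrite invr_ge0 ltW.
have n0 : 0 <= n%:R :> R by [].
have n1 : 1 <= n%:R :> R by rewrite ler1n (leq_trans _ n3).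
split; [by rewrite mulr_ge0 // addr_ge0 // !mulr_ge0 //; lra|by rewrite !mulr_ge0|].
move=> r r0; have ax := card_vertices_disk M r0.
have := geq_card_fset_set ax; rewrite -(ler_nat R) => /le_trans; apply.
rewrite /vertex_bound /packing_bound natrM natrX.
set k := Num.trunc _.
have kE : k.+1%:R <= 2 * (1 + diam) / delta + 1 + 2 / delta * r.
  have q0 : 0 <= 2 * (r + 1 + diam) / delta by rewrite !mulr_ge0 //; lra.
  have /andP[kq _] := truncn_itv q0; rewrite -natr1.
  move: kq; rewrite -/k !mulrDr !mulrDl; lra.
have k0 : 0 <= k.+1%:R :> R by [].
rewrite -[n%:R * _ * r]mulrA -mulrDr exprMn [X in X <= _]mulrC.
apply: ler_pM; rewrite ?exprn_ge0 //; first by rewrite expr2 ler_peMl.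
by rewrite ler_pXn2r ?nnegrE // (le_trans k0 kE).
Qed.

(** The patch lies between two concentric disks whose radii differ by
    [patch_margin]. If it had too many vertices outside the smaller one for all
    large radii, the number of vertices in the disks would grow exponentially
    with the radius, but it grows at most quadratically. *)
Lemma frequently_thin_margin (e : R) : 0 < e ->
  forall r1, exists2 r, r1 <= r & 0 < r /\ v r <= (1 + e) * a r.
Proof.
move=> e0 r1; apply: contrapT => nex.
have c0 : 0 < patch_margin by rewrite /patch_margin; have := diam0; lra.
pose r2 := Num.max r1 1.
have r2P : r1 <= r2 /\ 1 <= r2 by rewrite !le_max !lexx orbT.
have grow r : r2 <= r -> (1 + e) * a r <= a (r + patch_margin).
  move=> r2r; have r0 : 0 < r by lra.
  apply: le_trans (v_le_disk r0).
  rewrite leNgt; apply/negP => vr; apply: nex; exists r; first by lra.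
  by split=> //; exact: ltW.
pose s k := r2 + patch_margin + k%:R * patch_margin.
have s2 k : r2 <= s k.
  have : 0 <= k%:R * patch_margin by rewrite mulr_ge0 // ltW.
  by rewrite /s; lra.
have a1 : 1 <= a (s 0%N).
  rewrite /s mul0r addr0.
  have r20 : 0 < r2 by lra.
  have := lt_le_trans (v_gt0 r20) (v_le_disk r20).
  by rewrite ltr0n ler1n.
have expo k : (1 + e) ^+ k <= a (s k).
  elim: k => [|k IH]; first by rewrite expr0.
  have -> : s k.+1 = s k + patch_margin by rewrite /s -natr1; ring.
  apply: le_trans (grow _ (s2 k)); rewrite exprS ler_pM2l //; lra.
have [A [B [A0 B0 AB]]] := quadratic_growth.
have [k] := @exp_beats_quadratic R e (A + B * (r2 + patch_margin)) (B * patch_margin) e0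
  ltac:(rewrite addr_ge0 // mulr_ge0 //; lra) ltac:(rewrite mulr_ge0 //; lra).
rewrite ltNge => /negP; apply; apply: le_trans (expo k) _.
have sk0 : 0 <= s k by have := s2 k; lra.
apply: le_trans (AB _ sk0) _; rewrite le_eqVlt; apply/orP; left; apply/eqP.
by rewrite /s; ring.
Qed.

End Growth.

(** * Limits *)

Section Limits.
Context {M : plane}.
Local Notation t r := (t_ Tl r M).
Local Notation v r := (v_ Tl r M).
Local Notation vj j r := (vj_ Tl j r M).
Local Notation N := (packing_bound diam).

Lemma vjE j r : 0 < r ->
  vj j r = \sum_(x <- fset_set (patch_vertices Tl r M)) (valence x == j)%:R.
Proof.
move=> r0; rewrite /vj_ /ncard.
rewrite -natr_sum; congr _%:R.
rewrite -big_mkcond sum1_count -size_filter; apply/perm_size/uniq_perm.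
- exact: fset_uniq.
- by rewrite filter_uniq // fset_uniq.
- move=> x; rewrite mem_filter in_fset_set ?inE; last first.
    apply: sub_finite_set (finite_patch_vertices M r0); by move=> y [].
  rewrite in_fset_set ?inE; last exact: finite_patch_vertices.
  apply/idP/idP => [/asboolP[Vx /has_valenceP ->]|/andP[/eqP vx /asboolP Vx]].
    by rewrite eqxx; apply/asboolP.
  by apply/asboolP; split=> //; apply/has_valenceP.
Qed.

Lemma sum_vj (f : nat -> R) r : 0 < r ->
  \sum_(3 <= j < N.+1) f j * vj j r =
  \sum_(x <- fset_set (patch_vertices Tl r M)) f (valence x).
Proof.
move=> r0; under eq_bigr do rewrite vjE // big_distrr /=.
rewrite exchange_big /= big_seq [RHS]big_seq; apply: eq_bigr => x.
move=> /(in_patch_vertices r0)[Vx _]; apply: sum_by_value.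
by rewrite ltnS valence_ge3 // valence_le.
Qed.

Lemma sum_vj_le r : 0 < r ->
  \sum_(3 <= j < N.+1) j%:R * vj j r + N%:R * #|` @disk_vertices M r|%:R <=
  2 * v r + 2 * t r + N%:R * v r.
Proof.
move=> r0; rewrite (sum_vj (fun j => j%:R)) // -natr_sum.
have := @sum_valence M r r0.
(* Otherwise [natrM] would unfold the bound, which is a square. *)
by move: (N) => k; rewrite /v_ /t_ /ncard -(ler_nat R) !natrD !natrM; lra.
Qed.

Lemma vj_eq0 j r : 0 < r -> (N < j)%N -> vj j r = 0.
Proof.
move=> r0 Nj; rewrite vjE // big1 // => x _.
by rewrite ltn_eqF // (leq_ltn_trans (valence_le x)).
Qed.

Hypothesis cvg_vj : forall j, cvg (vj j r / t r @[r --> +oo]).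
Local Notation L j := (vj_lim Tl M j).

Lemma pos_near : \forall r \near +oo, 0 < r :> R.
Proof. exact: nbhs_pinfty_gt. Qed.

Lemma sum_cvg (f : nat -> R) :
  \sum_(3 <= j < N.+1) f j * (vj j r / t r) @[r --> +oo] -->
  \sum_(3 <= j < N.+1) f j * L j.
Proof.
elim: (index_iota 3 N.+1) => [|j s IH].
  by rewrite big_nil; under eq_fun do rewrite big_nil; exact: cvg_cst.
rewrite big_cons; under eq_fun do rewrite big_cons.
by apply: cvgD IH; apply: cvgMr; exact: cvg_vj.
Qed.

Lemma v_cvg : v r / t r @[r --> +oo] --> \sum_(3 <= j < N.+1) L j.
Proof.
have -> : \sum_(3 <= j < N.+1) L j = \sum_(3 <= j < N.+1) 1 * L j.
  by apply: eq_bigr => j _; rewrite mul1r.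
apply: cvg_trans (@sum_cvg (fun=> 1)); apply: near_eq_cvg; near=> r.
have r0 : 0 < r by near: r; exact: pos_near.
under eq_bigr do rewrite mulrA; rewrite -mulr_suml (sum_vj (fun=> 1)) //.
by rewrite /v_ /ncard -sum1_size natr_sum.
Unshelve. all: by end_near. Qed.

Lemma v_limE : v_lim Tl M = \sum_(3 <= j < N.+1) L j.
Proof. exact: cvg_lim v_cvg. Qed.

Lemma vj_lim_ge0 j : 0 <= L j.
Proof.
apply: limr_ge; first exact: cvg_vj.
by apply: nearW => r; rewrite divr_ge0 // /ncard.
Qed.

Lemma vj_lim_eq0 j : (N < j)%N -> L j = 0.
Proof.
move=> Nj; apply: cvg_lim => //; apply: cvg_near_cst; near=> r.
by rewrite vj_eq0 ?mul0r //; near: r; exact: pos_near.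
Unshelve. all: by end_near. Qed.

Lemma le_v_lim : n%:R - 2 <= 2 * v_lim Tl M.
Proof.
rewrite v_limE; have h : 2 * (v r / t r) @[r --> +oo] --> 2 * \sum_(3 <= j < N.+1) L j.
  by apply: cvgMr; exact: v_cvg.
apply: (cvgr_to_ge h); near=> r.
have r0 : 0 < r by near: r; exact: pos_near.
by rewrite mulrA ler_pdivlMr ?t_gt0 // le_t_v.
Unshelve. all: by end_near. Qed.

(** Both sides are limits of ratios that exist, so it suffices to compare the
    ratios along arbitrarily large radii, and these can be chosen such that the
    margin of the patch is negligible. *)
Lemma sum_valence_lim :
  \sum_(3 <= j < N.+1) j%:R * L j <= 2 * v_lim Tl M + 2.
Proof.
set S := \sum_(3 <= j < N.+1) _; set V := v_lim Tl M.
have V0 : 0 <= V by rewrite /V v_limE sumr_ge0 // => j _; exact: vj_lim_ge0.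
suff main e : 0 < e -> S <= 2 * V + 2 + N%:R * e * V.
  apply/ler_addgt0Pr => e e0.
  have NV : 0 < N%:R * V + 1 by rewrite ltr_wpDl // mulr_ge0.
  apply: le_trans (main (e / (N%:R * V + 1)) _) _; first by rewrite divr_gt0.
  rewrite lerD2l mulrAC mulrA ler_pdivrMr // mulrDr mulr1 mulrC lerDl ltW //.
move=> e0; rewrite leNgt; apply/negP => SV.
have dcvg : \sum_(3 <= j < N.+1) j%:R * (vj j r / t r) - (2 + N%:R * e) * (v r / t r)
    @[r --> +oo] --> S - (2 + N%:R * e) * V.
  apply: cvgB; first exact: @sum_cvg (fun j => j%:R).
  by apply: cvgMr; rewrite /V v_limE; exact: v_cvg.
have /(cvgr_gt _ dcvg) [r1 [_ near_r]] : 2 < S - (2 + N%:R * e) * V by lra.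
have [r r1r [r0 thin]] := @frequently_thin_margin M e e0 (r1 + 1).
have /near_r : r1 < r by lra.
under eq_bigr do rewrite mulrA; rewrite -mulr_suml mulrA -mulrBl.
rewrite ltr_pdivlMr ?t_gt0 //; apply/negP; rewrite -leNgt.
have := sum_vj_le r0; have := @disk_le_v M r r0.
move: thin; set a := #|` disk_vertices r|%:R.
have N0 : 0 <= N%:R :> R by [].
move: (\sum_(3 <= j < N.+1) _) (v r) (t r) a (N%:R) N0 => s x y z k k0 h1 h2 h3.
have : k * x <= k * (z + e * z) by rewrite ler_wpM2l //; lra.
have : k * (e * z) <= k * (e * x) by rewrite ler_wpM2l // ler_wpM2l // ltW.
lra.
Qed.

Lemma w_series :
  (\sum_(3 <= j <oo) (j%:R * w_ Tl M j)%:E =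
   ((\sum_(3 <= j < N.+1) j%:R * L j) / v_lim Tl M)%:E)%E.
Proof.
apply: cvg_lim => //; apply: cvg_near_cst; near=> m.
have mN : (N < m)%N by near: m; exact: nbhs_infty_gt.
rewrite sumEFin; congr _%:E; rewrite mulr_suml.
have [N3|N3] := leqP 3 N.+1; last first.
  rewrite [in RHS]big_geq ?(ltnW N3) // big_nat_cond big1 // => j.
  case/andP=> /andP[j3 _] _.
  by rewrite /w_ vj_lim_eq0 ?mul0r ?mulr0 // (leq_trans (ltnW N3) j3).
rewrite (@big_cat_nat _ _ _ N.+1) //=.
rewrite [X in _ + X]big_nat_cond [X in _ + X]big1 ?addr0; last first.
  by move=> j /andP[/andP[Nj _] _]; rewrite /w_ vj_lim_eq0 // mul0r mulr0.
by apply: eq_bigr => j _; rewrite /w_ mulrA.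
Unshelve. all: by end_near. Qed.

Lemma mean_valence :
  (3%:E <= \sum_(3 <= j <oo) (j%:R * w_ Tl M j)%:E)%E /\
  (\sum_(3 <= j <oo) (j%:R * w_ Tl M j)%:E <= (2 * n%:R / (n%:R - 2))%:E)%E.
Proof.
have n3R : 3 <= n%:R :> R by rewrite ler_nat.
have V0 : 0 < v_lim Tl M by have := le_v_lim; lra.
rewrite w_series !lee_fin; split.
  rewrite ler_pdivlMr // v_limE mulr_sumr big_nat_cond [X in _ <= X]big_nat_cond.
  apply: ler_sum => j /andP[/andP[j3 _] _].
  by rewrite ler_wpM2r ?vj_lim_ge0 // ler_nat.
rewrite ler_pdivrMr //; apply: le_trans sum_valence_lim _.
have n2 : 0 < n%:R - 2 :> R by lra.
rewrite mulrAC ler_pdivlMr //; have := le_v_lim; nra.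
Qed.

End Limits.

End Tiles.

Theorem proposition2 (R : realType) (n : nat) (hn : (3 <= n)%N)
    (Tl : set (set (R * R))) (M : R * R)
    (hbal : strongly_balanced Tl M)
    (hgon : forall T, Tl T -> convex_ngon n T) :
  (3%:E <= \sum_(3 <= j <oo) (j%:R * w_ Tl M j)%:E)%E /\
  (\sum_(3 <= j <oo) (j%:R * w_ Tl M j)%:E <= (2 * n%:R / (n%:R - 2))%:E)%E.
Proof.
have [[tilingT _ _ [u [U [u0 U0 uU]]]] _ cvg_vj] := hbal.
have u20 : 0 < u / 2 by rewrite divr_gt0.
have thick T : Tl T -> exists a : R * R, ball a (u / 2) `<=` T.
  move=> /uU[[a aT] _]; exists a.
  by apply: subset_trans aT; apply: ball_sub_disk; exact: ltW.
have U20 : 0 < (U + 1) + (U + 1) by lra.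
have small T x y : Tl T -> T x -> T y -> ball x ((U + 1) + (U + 1)) y.
  move=> /uU[_ [b Tb]] /Tb/(disk_sub_ball (ltW U0)) bx.
  move=> /Tb/(disk_sub_ball (ltW U0)); apply: ball_triangle; exact: ball_sym.
exact: (mean_valence hn hgon tilingT u20 thick U20 small cvg_vj).
Qed.
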